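(* Let $R/I$ be a $2$-dimensional ring with Noether normalization $A=K[x_{n-1},x_n]$, such that $x_n$ is a nonzero divisor on $R/I$. Then its (weighted) Hilbert series is $$HS_{R/I}(t)=\frac{\sum_{v\in\mathcal B_0}t^{\deg_\omega(v)}-\sum_{u\in\mathcal B_1}t^{\deg_\omega(u)+\delta_u\omega_{n-1}}}{(1-t^{\omega_{n-1}})(1-t^{\omega_n})}.$$
   Context: $K$ is an infinite field, $R=K[x_1,\dots,x_n]$, $\omega=(\omega_1,\dots,\omega_n)\in(\mathbb Z^+)^n$, $I\subset R$ is an ideal homogeneous for the grading $\deg_\omega(x_i)=\omega_i$. That $A$ is a Noether normalization of $R/I$ means that $A\hookrightarrow R/I$ is an integral ring extension. $HS_{R/I}(t)=\sum_{i\ge0}\dim_K((R/I)_i)\,t^i$, with $(R/I)_i$ the degree $i$ component for $\deg_\omega$. $\mathrm{in}(\cdot)$ denotes the initial ideal with respect to the weighted degree reverse lexicographic order $>_\omega$: $x^\alpha>_\omega x^\beta$ iff $\deg_\omega(x^\alpha)>\deg_\omega(x^\beta)$, or these degrees are equal and the last nonzero entry of $\alpha-\beta$ is negative. $\mathcal B_0$ is the (finite) set of monomials of $R$ not belonging to $\mathrm{in}(I+(x_{n-1},x_n))$. $\chi:R\to R$ is the evaluation morphism with $x_i\mapsto x_i$ for $i\le n-2$ and $x_{n-1},x_n\mapsto1$; $J:=\chi(\mathrm{in}(I))\cdot R$; $\mathcal B_1:=\mathcal B_0\cap J$. For $u\in\mathcal B_1$, $\delta_u:=\min\{\delta\mid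 u\,x_{n-1}^\delta\in\mathrm{in}(I)\}$. *)

(* Defs.v *)
From HB Require Import structures.
From mathcomp Require Import all_boot all_order all_algebra.
From mathcomp Require Import ring_quotient.
From mathcomp Require Import boolp classical_sets cardinality fsbigop.
From mathcomp Require Import mpoly.

Set Implicit Arguments.
Unset Strict Implicit.
Unset Printing Implicit Defensive.

Import GRing.Theory.

Local Open Scope classical_set_scope.
Local Open Scope quotient_scope.
Local Open Scope ring_scope.

Section CommutativeAlgebra.
Variable A : comNzRingType.

Definition ideal_gen (S : set A) : set A :=
  [set x | exists2 s : seq (A * A),
    (forall q, q \in s -> S q.2) & x = \sum_(q <- s) q.1 * q.2].

(* l is the number of strict inclusions. [prime_idealr] ranges over boolean
   predicates, hence (classically) over all prime ideals. *)
Definition prime_chain (l : nat) (P : 'I_l.+1 -> prime_idealr A) : Prop :=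
  forall i j : 'I_l.+1, (i < j)%N ->
    {subset P i <= P j} /\ exists2 x, x \in P j & x \notin P i.

Definition has_krull_dim (d : nat) : Prop :=
  (exists P : 'I_d.+1 -> prime_idealr A, prime_chain P) /\
  (forall l (P : 'I_l.+1 -> prime_idealr A), prime_chain P -> (l <= d)%N).

End CommutativeAlgebra.

Definition noether_normalization (A B : comNzRingType)
    (f : {rmorphism A -> B}) : Prop :=
  injective f /\ integralRange f.

Section WeightedDegree.
Variables (n : nat) (w : 'I_n -> nat).

Definition wdeg (m : 'X_{1..n}) : nat := (\sum_(i < n) m i * w i)%N.

Lemma wdeg0 : wdeg 0%MM = 0%N.
Proof. by rewrite /wdeg big1 // => i _; rewrite mnm0E mul0n. Qed.

Lemma wdegD : {morph wdeg : m1 m2 / (m1 + m2)%MM >-> (m1 + m2)%N}.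
Proof.
move=> m1 m2; rewrite /wdeg -big_split; apply: eq_bigr => i _.
by rewrite mnmDE mulnDl.
Qed.

HB.instance Definition _ := isMeasure.Build n wdeg wdeg0 wdegD.

Definition wrevlex_gt (a b : 'X_{1..n}) : bool :=
  (wdeg b < wdeg a)%N ||
  (wdeg a == wdeg b) &&
    [exists i : 'I_n, (a i < b i)%N &&
       [forall j : 'I_n, (i < j)%N ==> (a j == b j)]].

Section Ideals.
Variable K : fieldType.

Definition wlead (p : {mpoly K[n]}) (m : 'X_{1..n}) : Prop :=
  m \in msupp p /\
  forall m', m' \in msupp p -> m' != m -> wrevlex_gt m m'.

Definition initial_ideal (I : set {mpoly K[n]}) : set {mpoly K[n]} :=
  ideal_gen [set q | exists p m, [/\ I p, wlead p m & q = 'X_[m]]].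

Definition whomogeneous (I : {pred {mpoly K[n]}}) : Prop :=
  forall p d, p \in I -> pihomog wdeg d p \in I.

End Ideals.
End WeightedDegree.

Section Quotient.
Variables (n : nat) (K : fieldType) (I : idealr {mpoly K[n]}).
Local Notation Q := {ideal_quot I}.

(* c . x is written \pi (c%:MP) * x, the K-vector space structure of R/I. *)
Definition quot_lincomb (k : nat) (c : 'I_k -> K) (b : 'I_k -> Q) : Q :=
  \sum_(i < k) \pi_Q (c i)%:MP * b i.

Definition quot_basis (V : set Q) (k : nat) (b : 'I_k -> Q) : Prop :=
  [/\ forall i, V (b i),
      forall x, V x -> exists c, x = quot_lincomb c b
    & forall c, quot_lincomb c b = 0 -> forall i, c i = 0].

(* Dimension over K of a subspace V; 0 by convention when V is infinite
   dimensional. *)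
Definition quot_dim (V : set Q) : nat :=
  xget 0%N [set k | exists b : 'I_k -> Q, quot_basis V b].

Definition quot_component (w : 'I_n -> nat) (d : nat) : set Q :=
  [set \pi_Q p | p in [set p | p \is d.-homog for (wdeg w)]].

(* Formal power series with integer coefficients are functions nat -> int. *)
Definition hilbert_series (w : 'I_n -> nat) : nat -> int :=
  fun d => (quot_dim (quot_component w d))%:Z.

End Quotient.

(* f = N / D in the ring of formal power series over int, where D is
   invertible. *)
Definition series_eq_frac (f : nat -> int) (N D : {poly int}) : Prop :=
  D`_0 \is a GRing.unit /\
  forall k, \sum_(i < k.+1) f i * D`_(k - i) = N`_k.

(* The ring K[x_1, ..., x_(n+2)]. Its last two variables, x_(n+1) and x_(n+2),
   have indices [pen] and [ord_max]. *)
Section LastTwoVariables.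
Variables (K : fieldType) (n : nat).
Local Notation R := {mpoly K[n.+2]}.

Definition pen : 'I_n.+2 := inord n.

(* K[x_(n+1), x_(n+2)] -> R -> R/I, with the polynomial subring presented as a
   polynomial ring in two variables. *)
Definition last2_embed (I : idealr R) :
    {rmorphism {mpoly K[2]} -> {ideal_quot I}} :=
  \pi_{ideal_quot I} \o comp_mpoly [tuple 'X_pen; 'X_ord_max].

Definition chi (p : R) : R :=
  p \mPo [tuple (if (i < n)%N then 'X_i else 1) | i < n.+2].

Variables (w : 'I_n.+2 -> nat) (I : set R).

Definition B0 : set 'X_{1..n.+2} :=
  [set v | ~ initial_ideal w
     (ideal_gen (I `|` [set 'X_pen; 'X_ord_max])) 'X_[v]].

Definition J : set R := ideal_gen (chi @` initial_ideal w I).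

Definition B1 : set 'X_{1..n.+2} := B0 `&` [set u | J 'X_[u]].

Definition delta (u : 'X_{1..n.+2}) : nat :=
  xget 0%N [set d | initial_ideal w I ('X_[u] * 'X_pen ^+ d) /\
    forall e, initial_ideal w I ('X_[u] * 'X_pen ^+ e) -> (d <= e)%N].

End LastTwoVariables.

(* Main.v *)
(** Since [I] is homogeneous, the monomials outside [in(I)] (the standard ones)
    of degree [d] form a basis of [(R/I)_d], so the Hilbert series counts standard
    monomials. For the reverse lexicographic order, a homogeneous polynomial whose
    leading monomial is divisible by the last variable [y] is itself divisible by
    [y]; as [y] is a nonzero divisor modulo [I], it is then a nonzero divisor modulo
    [in(I)] too, and it suffices to count the standard monomials free of [y]. The
    next variable [x] acts on these: [v x^k] with [v] free of [x] and [y] is standard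
    for every [k] if [v] is in B0 but not in B1, and exactly for [k < delta_v] if [v]
    is in B1. Finally, the component of degree [k w_i] of an equation of degree [k]
    expressing that [x_i] is integral over [K[x, y]] has leading monomial [x_i^k],
    so B0 is finite. *)
Require Import Defs.
From HB Require Import structures.
From mathcomp Require Import all_boot all_order all_algebra.
From mathcomp Require Import ring_quotient.
From mathcomp Require Import boolp classical_sets functions cardinality fsbigop.
From mathcomp Require Import mpoly.

Set Implicit Arguments.
Unset Strict Implicit.
Unset Printing Implicit Defensive.

Import GRing.Theory.

Local Open Scope classical_set_scope.
Local Open Scope quotient_scope.
Local Open Scope ring_scope.

(** * Weighted reverse lexicographic order, leading monomials and initial ideals *)

Section WeightedRevlex.
Variables (n : nat) (w : 'I_n -> nat).
Implicit Types a b c m : 'X_{1..n}.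
Local Notation gt := (wrevlex_gt w).

Lemma wrevlex_irr a : gt a a = false.
Proof.
rewrite /wrevlex_gt ltnn eqxx /=; apply/existsP => -[i].
by rewrite ltnn.
Qed.

Lemma wrevlex_wdeg a b : gt a b -> (wdeg w b <= wdeg w a)%N.
Proof.
by rewrite /wrevlex_gt => /orP[/ltnW//|/andP[/eqP-> _]].
Qed.

Lemma wrevlex_gtP a b : wdeg w a = wdeg w b ->
  reflect (exists2 i, (a i < b i)%N & forall j : 'I_n, (i < j)%N -> a j = b j)
    (gt a b).
Proof.
move=> ab; rewrite /wrevlex_gt ab ltnn eqxx /=.
apply: (iffP existsP) => -[i].
  by case/andP=> h /forallP g; exists i => // j ij; apply/eqP; have := g j; rewrite ij.
by move=> h g; exists i; rewrite h; apply/forallP => j; apply/implyP => /g ->.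
Qed.

Lemma wrevlex_trans b a c : gt a b -> gt b c -> gt a c.
Proof.
move=> ab bc; have ba := wrevlex_wdeg ab; have cb := wrevlex_wdeg bc.
have [/eqP eac|nac] := boolP (wdeg w a == wdeg w c); last first.
  by rewrite /wrevlex_gt ltn_neqAle eq_sym nac (leq_trans cb ba).
have eab : wdeg w a = wdeg w b by apply/eqP; rewrite eqn_leq ba eac cb.
have ebc : wdeg w b = wdeg w c by rewrite -eab.
case/(wrevlex_gtP eab): ab => i abi ab; case/(wrevlex_gtP ebc): bc => j bcj bc.
(* The larger of the two deciding indices [i] and [j] decides between [a] and [c]. *)
apply/(wrevlex_gtP eac); case: (ltngtP i j) => ij.
- by exists j => [|k jk]; [rewrite ab | rewrite ab ?bc// (ltn_trans ij)].
- by exists i => [|k ik]; [rewrite -bc | rewrite ab ?bc// (ltn_trans ij)].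
- have eij : i = j by exact: val_inj.
  exists i => [|k ik]; last by rewrite ab ?bc// -ij.
  by apply: ltn_trans abi _; rewrite eij.
Qed.

Lemma wrevlex_total a b : a != b -> gt a b || gt b a.
Proof.
move=> nab; case: (ltngtP (wdeg w a) (wdeg w b)) => e.
- by rewrite /wrevlex_gt e orbT.
- by rewrite /wrevlex_gt e.
have [i0 hi0] : exists i, a i != b i.
  apply/existsP; apply: contraNT nab; rewrite negb_exists => /forallP h.
  by apply/eqP/mnmP => i; have := h i; rewrite negbK => /eqP.
(* The last index at which [a] and [b] differ decides. *)
have [i nabi imax] := @arg_maxnP _ i0 (fun i => a i != b i) (@nat_of_ord n) hi0.
have h (j : 'I_n) : (i < j)%N -> a j = b j.
  by move=> ij; apply/eqP; apply: contraLR ij => /imax; rewrite -leqNgt.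
case: (ltngtP (a i) (b i)) nabi => // abi _.
  by apply/orP; left; apply/(wrevlex_gtP e); exists i.
apply/orP; right; apply/(wrevlex_gtP (esym e)).
by exists i => // j /h.
Qed.

Lemma wrevlex_addr c a b : gt (a + c)%MM (b + c)%MM = gt a b.
Proof.
rewrite /wrevlex_gt !wdegD ltn_add2r eqn_add2r.
congr (_ || _ && _); apply: eq_existsb => i.
rewrite !mnmDE ltn_add2r; congr (_ && _).
by apply: eq_forallb => j; rewrite !mnmDE eqn_add2r.
Qed.

Lemma mdeg_le_wdeg (w_gt0 : forall i, (0 < w i)%N) m : (mdeg m <= wdeg w m)%N.
Proof. by rewrite mdegE /wdeg leq_sum // => i _; rewrite leq_pmulr. Qed.

Lemma wdeg1 i : wdeg w U_(i)%MM = w i.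
Proof.
rewrite /wdeg (bigD1 i) //= mnm1E eqxx mul1n big1 ?addn0 // => j ji.
by rewrite mnm1E eq_sym (negPf ji).
Qed.

Lemma wdegMn m k : wdeg w (m *+ k)%MM = (wdeg w m * k)%N.
Proof.
rewrite /wdeg big_distrl /=; apply: eq_bigr => i _.
by rewrite mulmnE mulnAC.
Qed.

Lemma finite_mdeg_lt N : finite_set [set m : 'X_{1..n} | (mdeg m < N)%N].
Proof.
suff -> : [set m : 'X_{1..n} | (mdeg m < N)%N] = (val : 'X_{1..n < N} -> _) @` setT.
  exact/finite_image/finite_finset.
apply/seteqP; split=> [m /= hm|m [m' _ <-]]; last exact: bmdeg.
by exists (BMultinom hm).
Qed.

Lemma finite_wdeg (w_gt0 : forall i, (0 < w i)%N) d :
  finite_set [set m | wdeg w m = d].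
Proof.
apply: sub_finite_set (finite_mdeg_lt d.+1) => m /= <-.
exact: mdeg_le_wdeg.
Qed.

Section Lead.
Variable K : fieldType.
Implicit Types p q : {mpoly K[n]}.

Lemma wlead_exists p : p != 0 -> exists m, wlead w p m.
Proof.
rewrite -msupp_eq0 /wlead.
suff H (s : seq 'X_{1..n}) : s != [::] ->
    exists m, m \in s /\ forall m', m' \in s -> m' != m -> gt m m' by exact: H.
elim: s => // a [|b s] IH _.
  by exists a; rewrite inE eqxx; split=> // m'; rewrite inE => /eqP ->; rewrite eqxx.
case: IH => // m [ms mmax].
have [->|am] := eqVneq a m.
  exists m; rewrite inE eqxx; split=> // m'; rewrite inE => /orP[/eqP->|]; last exact: mmax.
  by rewrite eqxx.
have [gam|gma] := orP (wrevlex_total am).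
  exists a; rewrite inE eqxx; split=> // m'; rewrite inE => /orP[/eqP->|m's _].
    by rewrite eqxx.
  by have [->//|/(mmax _ m's)] := eqVneq m' m; exact: wrevlex_trans.
exists m; rewrite inE ms orbT; split=> // m'; rewrite inE => /orP[/eqP->//|].
exact: mmax.
Qed.

Lemma mcoeff_pihomog d p m :
  (pihomog (wdeg w) d p)@_m = if wdeg w m == d then p@_m else 0.
Proof.
rewrite pihomogE raddf_sum /=.
under eq_bigr do rewrite mcoeffZ mcoeffX mulr_natr mulrb.
rewrite -big_mkcondr /=; case: ifP => md; last first.
  rewrite big1 // => m' /andP[h /eqP e].
  by rewrite -e h in md.
case: (boolP (m \in msupp p)) => mp; last first.
  rewrite memN_msupp_eq0 // big_seq_cond big1 // => m' /and3P[h _ /eqP e].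
  by rewrite -e h in mp.
rewrite big_mkcond (bigD1_seq m) ?msupp_uniq //= md eqxx big1 ?addr0 // => m' ne.
by rewrite (negPf ne) andbF.
Qed.

Lemma mem_msupp_pihomog d p m :
  (m \in msupp (pihomog (wdeg w) d p)) = (wdeg w m == d) && (m \in msupp p).
Proof. by rewrite !mcoeff_msupp mcoeff_pihomog; case: ifP; rewrite ?eqxx. Qed.

Lemma wlead_pihomog p m :
  wlead w p m -> wlead w (pihomog (wdeg w) (wdeg w m) p) m.
Proof.
case=> mp mmax; split=> [|m']; first by rewrite mem_msupp_pihomog eqxx.
by rewrite mem_msupp_pihomog => /andP[_]; exact: mmax.
Qed.

Lemma wleadMX p m c : wlead w p m -> wlead w (p * 'X_[c]) (m + c)%MM.
Proof.
case=> mp mmax; split=> [|m'].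
  by rewrite mcoeff_msupp addmC mcoeffMX -mcoeff_msupp.
rewrite (perm_mem (msuppMX _ _)) => /mapP[m1 m1p ->].
rewrite [(c + _)%MM]addmC wrevlex_addr => ne; apply: mmax => //.
by apply: contraNneq ne => ->.
Qed.

Lemma wlead_mulX_inv p m c : wlead w (p * 'X_[c]) (m + c)%MM -> wlead w p m.
Proof.
case; rewrite mcoeff_msupp addmC mcoeffMX -mcoeff_msupp => mp mmax.
split=> // m' m'p ne; rewrite -(wrevlex_addr c) ![(_ + c)%MM]addmC; apply: mmax.
  by rewrite (perm_mem (msuppMX _ _)) map_f.
by rewrite eqm_add2l.
Qed.

(** These are the exponents of the monomials of in(I) as soon as [I] is stable under multiplication
    by monomials ([initial_idealX]). Membership of a monomial in in(I) is thereby witnessed by a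
    single polynomial instead of a sum. *)
Definition lead_exps (I : set {mpoly K[n]}) : set 'X_{1..n} :=
  [set m | exists2 p, I p & wlead w p m].

Section InitialIdeal.
Variable I : set {mpoly K[n]}.
Hypothesis IM : forall p c, I p -> I (p * 'X_[c]).

Lemma lead_expsD m c : lead_exps I m -> lead_exps I (m + c)%MM.
Proof. by case=> p Ip pm; exists (p * 'X_[c]); [exact: IM|exact: wleadMX]. Qed.

(** Every monomial of a combination of leading monomials is a multiple of one of them. *)
Lemma initial_ideal_msupp p m :
  initial_ideal w I p -> m \in msupp p -> lead_exps I m.
Proof.
case=> s sI -> /msupp_sum_le /flattenP[_ /mapP[q + ->]].
rewrite mem_filter /= => /sI[q0 [m0 [Iq0 lq0 ->]]].
rewrite (perm_mem (msuppMX _ _)) => /mapP[m1 _ ->].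
by apply: lead_expsD; exists q0.
Qed.

Lemma initial_idealX m : initial_ideal w I 'X_[m] <-> lead_exps I m.
Proof.
split=> [h|[p Ip pm]]; first by apply: initial_ideal_msupp h _; rewrite msuppX inE.
exists [:: (1, 'X_[m])]; last by rewrite big_seq1 mul1r.
by move=> q; rewrite inE => /eqP -> /=; exists p, m.
Qed.

End InitialIdeal.
End Lead.
End WeightedRevlex.

(** * Dimension of subspaces of R/I *)

Section QuotientDimension.
Variables (n : nat) (K : fieldType) (I : idealr {mpoly K[n]}).
Local Notation Q := {ideal_quot I}.

Lemma pi_eq (p q : {mpoly K[n]}) : \pi_Q p = \pi_Q q <-> p - q \in I.
Proof. by rewrite Quotient.idealrBE; split=> [->|/eqP]. Qed.

Lemma pi_eq0 (p : {mpoly K[n]}) : \pi_Q p = 0 <-> p \in I.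
Proof. by rewrite -[0](raddf0 \pi_Q) pi_eq subr0. Qed.

Lemma pi_mul (p q : {mpoly K[n]}) : \pi_Q (p * q) = \pi_Q p * \pi_Q q.
Proof. exact: (rmorphM (\pi_Q : {rmorphism _ -> _})). Qed.

Lemma pi_sum T (r : seq T) P (F : T -> {mpoly K[n]}) :
  \pi_Q (\sum_(i <- r | P i) F i) = \sum_(i <- r | P i) \pi_Q (F i).
Proof. exact: (raddf_sum (\pi_Q : {rmorphism _ -> _})). Qed.

Lemma quot_lincombE k (c : 'I_k -> K) (p : 'I_k -> {mpoly K[n]}) :
  quot_lincomb c (fun i => \pi_Q (p i)) = \pi_Q (\sum_i c i *: p i).
Proof. by rewrite pi_sum; apply: eq_bigr => i _; rewrite -mul_mpolyC pi_mul. Qed.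

Lemma quot_lincomb_repr k (c : 'I_k -> K) (b : 'I_k -> Q) :
  quot_lincomb c b = \pi_Q (\sum_i c i *: repr (b i)).
Proof.
by rewrite -quot_lincombE; congr quot_lincomb; apply/funext => i; rewrite reprK.
Qed.

(** Expressing each family in the other gives matrices [A] and [A']. Freeness of [b] forces their
    product to be the identity of size [k], which bounds [k] by the inner size [l]. *)
Lemma quot_basis_le (V : set Q) k l (b : 'I_k -> Q) (b' : 'I_l -> Q) :
  quot_basis V b -> quot_basis V b' -> (k <= l)%N.
Proof.
case=> Vb spanb freeb [Vb' spanb' _].
have [M hM] := boolp.choice (fun i => spanb' _ (Vb i)).
have [M' hM'] := boolp.choice (fun j => spanb _ (Vb' j)).
pose A := \matrix_(i, j) M i j; pose A' := \matrix_(j, i) M' j i.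
apply: (@mulmx1_min _ _ _ A A'); apply/matrixP => i i'; rewrite !mxE.
apply/eqP; rewrite -subr_eq0; apply/eqP.
(* Freeness is applied to row [i] of [A *m A' - 1]. *)
apply: (freeb (fun i' => \sum_j A i j * A' j i' - (i == i')%:R)).
rewrite quot_lincomb_repr.
under eq_bigr do rewrite scalerBl scaler_suml.
rewrite sumrB exchange_big /= (bigD1 i) //= eqxx scale1r [X in _ - (_ + X)]big1 ?addr0; last first.
  by move=> j ne; rewrite eq_sym (negPf ne) scale0r.
rewrite raddfB /= reprK hM quot_lincomb_repr -raddfB pi_eq0 -sumrB.
apply: rpred_sum => j _; under eq_bigr do rewrite !mxE -scalerA.
rewrite -scaler_sumr -scalerBr -mul_mpolyC; apply: idealMr.
by apply/pi_eq; rewrite reprK hM' quot_lincomb_repr.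
Qed.

Lemma quot_dimE (V : set Q) k (b : 'I_k -> Q) : quot_basis V b -> quot_dim V = k.
Proof.
move=> Vb; apply: xget_unique => [|l [b' Vb']]; first by exists b.
by apply/eqP; rewrite eqn_leq !(quot_basis_le Vb Vb', quot_basis_le Vb' Vb).
Qed.

End QuotientDimension.

(** * Standard monomials and the Hilbert series *)

Section StandardMonomials.
Variables (n : nat) (w : 'I_n -> nat).
Hypothesis w_gt0 : forall i, (0 < w i)%N.
Variables (K : fieldType) (I : idealr {mpoly K[n]}).
Hypothesis I_homog : whomogeneous w I.
Local Notation Q := {ideal_quot I}.
Local Notation G := (lead_exps w [set p | p \in I]).
Local Notation gt := (wrevlex_gt w).

Lemma idealMX (p : {mpoly K[n]}) c : [set p | p \in I] p -> [set p | p \in I] (p * 'X_[c]).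
Proof. by move=> /= Ip; rewrite mulrC idealMr. Qed.

Lemma lead_exps_homog m : G m ->
  exists p, [/\ p \in I, wlead w p m & p \is (wdeg w m).-homog for (wdeg w)].
Proof.
case=> p Ip pm; exists (pihomog (wdeg w) (wdeg w m) p).
by split; [exact: I_homog|exact: wlead_pihomog|exact: pihomogP].
Qed.

(** Positive weights leave finitely many monomials in each degree, so the order is well founded
    there. *)
Lemma wrevlex_ind (P : 'X_{1..n} -> Prop) :
  (forall m, (forall m', gt m m' -> wdeg w m' = wdeg w m -> P m') -> P m) ->
  forall m, P m.
Proof.
move=> IH m0; pose d := wdeg w m0.
(* Total degree is at most weighted degree, so the monomials of weighted degree [d] all lie in the
   finite type ['X_{1..n < d.+1}]. The rank counts the elements of that type below [m]. *)
pose rank m := #|[pred m' : 'X_{1..n < d.+1} | gt m m']|.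
suff H N m : wdeg w m = d -> (rank m < N)%N -> P m by exact: H (ltnSn _).
elim: N m => // N IHN m md mN; apply: IH => m' mm' m'd.
apply: IHN; rewrite ?m'd //.
apply: leq_trans (_ : rank m <= N)%N; last by [].
have m'P : (mdeg m' < d.+1)%N by rewrite ltnS -md -m'd mdeg_le_wdeg.
apply: proper_card; apply/properP; split.
  by apply/fintype.subsetP => x; rewrite !inE; exact: wrevlex_trans.
by exists (BMultinom m'P); rewrite !inE //= wrevlex_irr.
Qed.

Section Span.
Variable r : seq 'X_{1..n}.
Let spanned (p : {mpoly K[n]}) :=
  exists c : 'X_{1..n} -> K, p - \sum_(m <- r) c m *: 'X_[m] \in I.

Let spanned_ideal p : p \in I -> spanned p.
Proof.
move=> Ip; exists (fun=> 0); rewrite big1 ?subr0 // => m _.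
by rewrite scale0r.
Qed.

Let spannedZD a p q : spanned p -> spanned q -> spanned (a *: p + q).
Proof.
case=> c Ic [c' Ic']; exists (fun m => a * c m + c' m).
under eq_bigr do rewrite scalerDl -scalerA.
rewrite big_split /= -scaler_sumr opprD addrACA -scalerBr.
by apply: rpredD => //; rewrite -mul_mpolyC idealMr.
Qed.

Let spanned_sum T (s : seq T) (P : pred T) (F : T -> K) (X : T -> {mpoly K[n]}) :
  (forall i, P i -> spanned (X i)) -> spanned (\sum_(i <- s | P i) F i *: X i).
Proof.
move=> h; elim/big_rec: _ => [|i p Pi]; first exact/spanned_ideal/idealr0.
by apply: spannedZD; exact: h.
Qed.

(** Modulo [I], a monomial of in(I) equals a combination of smaller monomials of the same degree.
    Induction along the order leaves only standard ones. *)
Lemma standard_span d (p : {mpoly K[n]}) : uniq r ->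
  (forall m, ~ G m -> wdeg w m = d -> m \in r) ->
  p \is d.-homog for (wdeg w) ->
  exists c : 'X_{1..n} -> K, p - \sum_(m <- r) c m *: 'X_[m] \in I.
Proof.
move=> r_uniq stdr; suff H m : wdeg w m = d -> spanned 'X_[m].
  move=> /dhomogP hp; rewrite (mpolyE p) big_seq_cond.
  by apply: spanned_sum => m; rewrite andbT => /hp /H.
elim/wrevlex_ind: m => m IH md.
have [|/stdr/(_ md) mr] := pselect (G m); last first.
  exists (fun m' => (m == m')%:R).
  rewrite (bigD1_seq m) //= eqxx scale1r big1 ?addr0 ?subrr ?idealr0 // => m' ne.
  by rewrite eq_sym (negPf ne) scale0r.
case/lead_exps_homog => q [Iq [mq mmax] /dhomogP hq].
have qm0 : q@_m != 0 by rewrite -mcoeff_msupp.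
(* The homogeneous element [q] of [I] with leading monomial [m] is solved for ['X_[m]]. *)
have -> : 'X_[m] = (q@_m)^-1 *: q + \sum_(m' <- msupp q | (m' \in msupp q) && (m' != m))
    - ((q@_m)^-1 * q@_m') *: 'X_[m'].
  rewrite {2}(mpolyE q) (bigD1_seq m) ?msupp_uniq //= scalerDr scalerA mulVf // scale1r.
  rewrite -addrA -big_seq_cond scaler_sumr -big_split big1 ?addr0 //= => m' _.
  by rewrite scaleNr -scalerA subrr.
apply: spannedZD; first exact: spanned_ideal.
apply: spanned_sum => m' /andP[m'q ne].
by apply: IH; [exact: mmax|exact: hq|rewrite hq].
Qed.
End Span.

Lemma hilbert_seriesE d :
  hilbert_series I w d = \sum_(m \in [set m | ~ G m /\ wdeg w m = d]) (1 : int).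
Proof.
set S := [set m | _]; have Sfin : finite_set S.
  by apply: sub_finite_set (finite_wdeg w_gt0 d) => m [].
(* A duplicate-free enumeration of the standard monomials of degree [d] indexes the basis. *)
have [r r_uniq rE] : exists2 r, uniq r & S = [set` r].
  have /finite_seqP[r ->] := Sfin.
  by exists (undup r); rewrite ?undup_uniq //; apply/seteqP; split=> m /=; rewrite mem_undup.
rewrite {1}rE -fsbig_seq //.
rewrite big_const_seq count_predT iter_addr_0 -[RHS]mulr_natr mul1r natz.
congr Posz; pose X (i : 'I_(size r)) := 'X_[K, tnth (in_tuple r) i].
have XS i : S (tnth (in_tuple r) i) by rewrite rE /= mem_tnth.
apply: (@quot_dimE _ _ _ _ _ (fun i => \pi_Q (X i))); split.
- by move=> i; exists (X i) => //=; rewrite dhomogX; apply/eqP; case: (XS i).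
- move=> _ [p /= hp <-].
  have [|c Ic] := standard_span r_uniq _ hp.
    by move=> m nG md; have Sm : S m := conj nG md; rewrite rE in Sm.
  exists (fun i => c (tnth (in_tuple r) i)); rewrite quot_lincombE.
  by apply/pi_eq; rewrite -(big_tnth _ _ r xpredT (fun m => c m *: 'X_[m])).
move=> c; rewrite quot_lincombE pi_eq0 => Iq i.
set q := \sum_i _ in Iq.
have qE m : q@_m = \sum_i c i *+ (tnth (in_tuple r) i == m).
  by rewrite (raddf_sum (mcoeff m)); apply: eq_bigr => j _; rewrite /= mcoeffZ mcoeffX mulr_natr.
apply/eqP/negPn/negP => ci0.
(* Since [r] has no repetition, [c i] is the coefficient of [q] at the monomial of index [i]. If it
   is nonzero, the leading monomial of [q] is both standard and in in(I). *)
have q0 : q != 0.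
  apply: contraNneq ci0 => q0; have := qE (tnth (in_tuple r) i).
  rewrite q0 mcoeff0 (bigD1 i) //= eqxx big1 ?addr0 => [/esym/eqP//|j ji].
  by rewrite (inj_eq (elimT (tuple_uniqP (in_tuple r)) r_uniq)) (negPf ji).
have [m mq] := wlead_exists w q0.
have [j /eqP jm] : exists j, tnth (in_tuple r) j == m.
  apply: contrapT => /forallNP h.
  case: mq => + _; rewrite mcoeff_msupp qE big1 ?eqxx // => j _.
  by case: (boolP (_ == m)) (h j).
have [] := XS j; rewrite jm => + _; apply.
by exists q.
Qed.
End StandardMonomials.

(** * Divisibility by monomials and generated ideals *)

Lemma mpolyX_dvd n (K : fieldType) (p : {mpoly K[n]}) c :
  (forall m, m \in msupp p -> (c <= m)%MM) -> exists q, p = q * 'X_[c].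
Proof.
move=> pc; exists (\sum_(m <- msupp p) p@_m *: 'X_[(m - c)%MM]).
rewrite {1}(mpolyE p) mulr_suml; apply: eq_big_seq => m /pc cm.
by rewrite -scalerAl -mpolyXD submK.
Qed.

Section IdealGen.
Variables (A : comNzRingType) (S : set A).

Lemma ideal_gen_sub x : S x -> ideal_gen S x.
Proof.
move=> Sx; exists [:: (1, x)]; last by rewrite big_seq1 mul1r.
by move=> q; rewrite inE => /eqP ->.
Qed.

Lemma ideal_genM a x : ideal_gen S x -> ideal_gen S (a * x).
Proof.
case=> s sS ->; exists [seq (a * q.1, q.2) | q <- s].
  by move=> _ /mapP[q /sS Sq ->].
by rewrite big_map mulr_sumr; apply: eq_bigr => q _; rewrite mulrA.
Qed.
End IdealGen.

(** * The last two variables: B0, J, B1 and delta in terms of leading exponents *)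

Section LastTwo.
Variables (K : fieldType) (n : nat) (w : 'I_n.+2 -> nat).
Hypothesis w_gt0 : forall i, (0 < w i)%N.
Local Notation R := {mpoly K[n.+2]}.
Local Notation M := 'X_{1..n.+2}.
Local Notation gt := (wrevlex_gt w).
Implicit Types (a b m u v : M) (p q : R).

Lemma val_pen : pen n = n :> nat. Proof. by rewrite inordK. Qed.

Lemma pen_neq_last : (pen n == ord_max) = false.
Proof. by apply/eqP => /(congr1 val) /=; rewrite val_pen => /eqP; rewrite ltn_eqF. Qed.

Lemma index_cases (i : 'I_n.+2) : [\/ (i < n)%N, i = pen n | i = ord_max].
Proof.
have := ltn_ord i; rewrite ltnS leq_eqVlt => /orP[/eqP e|].
  by apply: Or33; apply: val_inj.
rewrite ltnS leq_eqVlt => /orP[/eqP e|]; last exact: Or31.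
by apply: Or32; apply: val_inj; rewrite /= e val_pen.
Qed.

Lemma gt_pen_last (i : 'I_n.+2) : (pen n < i)%N -> i = ord_max.
Proof. by case: (index_cases i) => [lt|->|->//]; rewrite ?ltnn // val_pen ltnNge ltnW. Qed.

(** This is the property of the reverse lexicographic order that lets a power of [y] dividing the
    leading monomial of a homogeneous polynomial divide all its monomials. *)
Lemma wrevlex_last a b : wdeg w a = wdeg w b -> gt a b ->
  (a ord_max <= b ord_max)%N.
Proof.
move=> ab /(wrevlex_gtP ab)[i abi h].
have [<-|ne] := eqVneq i ord_max; first exact: ltnW.
by rewrite h // ltn_neqAle ne -ltnS ltn_ord.
Qed.

Lemma wrevlex_last2 a b : wdeg w a = wdeg w b ->
  a (pen n) = 0%N -> a ord_max = 0%N ->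
  (b (pen n) != 0%N) || (b ord_max != 0%N) -> gt a b.
Proof.
move=> ab ax ay h; apply/(wrevlex_gtP ab).
(* The deciding index is that of [y] if [b] involves [y], and that of [x] otherwise. *)
have [by0|by0] := posnP (b ord_max).
  exists (pen n); first by rewrite ax lt0n; rewrite by0 eqxx orbF in h.
  by move=> j /gt_pen_last ->; rewrite ay by0.
exists ord_max; first by rewrite ay.
by move=> j; rewrite ltnNge -ltnS ltn_ord.
Qed.

Section Ideal.
Variable I : idealr R.
Hypothesis I_homog : whomogeneous w I.
Local Notation Iset := [set p | p \in I].
Local Notation G := (lead_exps w Iset).
Local Notation Ux := (U_(pen n))%MM.
Local Notation Uy := (U_(ord_max : 'I_n.+2))%MM.

(** Adding [x] and [y] to [I] creates no new leading monomial free of both: in a given degree,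
    monomials free of [x] and [y] exceed all others, so such a leading monomial already comes from
    the part lying in [I]. *)
Lemma B0E v : B0 w Iset v <-> [/\ v (pen n) = 0%N, v ord_max = 0%N & ~ G v].
Proof.
set S := Iset `|` [set 'X_(pen n); 'X_ord_max].
have S_mul p c : ideal_gen S p -> ideal_gen S (p * 'X_[c]).
  by rewrite mulrC; exact: ideal_genM.
have decomp p : ideal_gen S p ->
    exists f g h, p = f + g * 'X_(pen n) + h * 'X_ord_max /\ f \in I.
  case=> s; elim: s p => [|q s IH] p sS ->.
    by exists 0, 0, 0; rewrite big_nil !mul0r !addr0 idealr0.
  have [|f [g [h [E If]]]] := IH _ _ erefl.
    by move=> r rs; apply: sS; rewrite inE rs orbT.
  rewrite big_cons {}E; case: (sS q) => [|Iq|[->|->]]; first by rewrite inE eqxx.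
  - exists (q.1 * q.2 + f), g, h; rewrite !addrA; split=> //.
    by rewrite rpredD // idealMr.
  - by exists f, (q.1 + g), h; rewrite mulrDl [f + (_ + _)]addrCA !addrA.
  - by exists f, g, (q.1 + h); rewrite mulrDl addrCA.
rewrite /B0 /= (initial_idealX w S_mul); split=> [nv|[vx vy nG] [p /decomp]].
  (* A variable of the enlarged ideal dividing ['X_[v]] would put [v] among its leading
     exponents. *)
  have mon i : ideal_gen S 'X_i -> v i = 0%N.
    move=> SX; apply: contrapT => /eqP; rewrite -lep1mP => iv; apply: nv.
    have X_lead : wlead w ('X_i : R) U_(i)%MM.
      rewrite /wlead msuppX inE; split=> // m'.
      by rewrite inE => /eqP ->; rewrite eqxx.
    rewrite -(submK iv) addmC; apply: (lead_expsD S_mul).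
    by exists 'X_i.
  split.
  - by apply: mon; apply: ideal_gen_sub; right; left.
  - by apply: mon; apply: ideal_gen_sub; right; right.
  by case=> p Ip pv; apply: nv; exists p => //; apply: ideal_gen_sub; left.
case=> f [g [h [-> If]]] pv; apply: nG.
(* In this component of [f], monomials involving [x] or [y] are below [v] by [wrevlex_last2]. The
   others have the same coefficient in [f] and in the whole sum, hence are below its leading
   monomial [v]. *)
exists (pihomog (wdeg w) (wdeg w v) f); first exact: I_homog.
have coeff0 m : m (pen n) = 0%N -> m ord_max = 0%N ->
    (g * 'X_(pen n) + h * 'X_ord_max)@_m = 0.
  move=> mx my; apply: memN_msupp_eq0; apply/negP => /msuppD_le.
  rewrite mem_cat !(perm_mem (msuppMX _ _)) => /orP[] /mapP[m1 _ e].
    by move: mx; rewrite e mnmDE mnm1E eqxx.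
  by move: my; rewrite e mnmDE mnm1E eqxx.
have [+ vmax] := pv; rewrite mcoeff_msupp -addrA mcoeffD coeff0 // addr0 => fv.
split=> [|m]; rewrite mem_msupp_pihomog ?eqxx -?mcoeff_msupp ?mcoeff_msupp //.
case/andP=> /eqP md fm ne; have [|] := boolP ((m (pen n) != 0%N) || (m ord_max != 0%N)).
  exact: wrevlex_last2.
rewrite negb_or !negbK => /andP[/eqP mx /eqP my]; apply: vmax => //.
by rewrite mcoeff_msupp -addrA mcoeffD coeff0 // addr0.
Qed.

(** Setting [x] and [y] to 1 erases their exponents; this is the effect of [chi] on exponents. *)
Definition truncate m : M := [multinom (if (i < n)%N then m i else 0%N) | i < n.+2].

Lemma chiX m : chi ('X_[m] : R) = 'X_[truncate m].
Proof.
rewrite /chi comp_mpolyX mpolyXE_id; apply: eq_bigr => i _.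
by rewrite tnth_mktuple mnmE; case: ifP; rewrite ?expr1n ?expr0.
Qed.

Lemma truncate_id m : m (pen n) = 0%N -> m ord_max = 0%N -> truncate m = m.
Proof.
move=> mx my; apply/mnmP => i; rewrite mnmE.
by case: (index_cases i) => [->//|->|->]; rewrite ?mx ?my; case: ifP.
Qed.

Lemma truncateU m (i : 'I_n.+2) k : (n <= i)%N -> truncate (m + U_(i) *+ k)%MM = truncate m.
Proof.
move=> ni; apply/mnmP => j; rewrite mnmE [RHS]mnmE mnmDE mulmnE mnm1E.
case: ifP => // jn; have [ij|] := eqVneq i j; last by rewrite addn0.
by rewrite -ij ltnNge ni in jn.
Qed.

Lemma JE u : u (pen n) = 0%N -> u ord_max = 0%N ->
  J w Iset 'X_[u] <-> exists k l, G (u + Ux *+ k + Uy *+ l)%MM.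
Proof.
move=> ux uy; split=> [[s sJ Es]|[k [l Gu]]]; last first.
  apply: ideal_gen_sub; exists 'X_[(u + Ux *+ k + Uy *+ l)%MM].
    exact/(initial_idealX w (@idealMX _ _ I)).
  by rewrite chiX !truncateU ?val_pen // truncate_id.
have : u \in msupp ('X_[u] : R) by rewrite msuppX inE.
rewrite Es => /msupp_sum_le /flattenP[_ /mapP[q + ->]].
rewrite mem_filter /= => /sJ[q0 Iq0 <-] /msuppM_le/allpairsP[[m1 m2] /= [_ + E]].
(* The monomial [m2] of [chi q0] divides ['X_[u]] and is the truncation of some monomial [g] of
   [q0]. *)
rewrite (mpolyE q0) /chi raddf_sum => /msupp_sum_le /flattenP[_ /mapP[g + ->]].
rewrite mem_filter /= => gq0; rewrite comp_mpolyZ => /msuppZ_le.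
rewrite -/(chi _) chiX msuppX inE => /eqP m2E.
have Gg := initial_ideal_msupp (@idealMX _ _ I) Iq0 gq0.
(* Restoring the exponents erased from [g] makes the product divisible by [g], which is in in(I). *)
exists (g (pen n)), (g ord_max).
rewrite -[(_ + _)%MM](@submK _ g) 1?addmC; first exact: (lead_expsD (@idealMX _ _ I)).
apply/mnm_lepP => i; rewrite !mnmDE !mulmnE !mnm1E.
case: (index_cases i) => [ilt|->|->]; rewrite ?eqxx ?mul1n.
- by rewrite E m2E mnmDE [truncate _ _]mnmE ilt -!addnA [(m1 i + _)%N]addnCA addnCA leq_addr.
- by rewrite addnA leq_addl.
- by rewrite leq_addr.
Qed.

Section NonZeroDivisor.
Hypothesis last_nzd : GRing.lreg (\pi_{ideal_quot I} 'X_ord_max).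

(** Factors [y] are removed one at a time: a homogeneous [p] in [I] with leading exponent [m' + Uy]
    is [q * y], and [q] is in [I] because [y] is regular on R/I. *)
Lemma lead_exps_last m k : G (m + Uy *+ k)%MM <-> G m.
Proof.
split; last exact: (lead_expsD (@idealMX _ _ I)).
elim: k => [|k IH]; first by rewrite mulm0n addm0.
rewrite mulmSr addmA => Gm; apply: IH; move: Gm; set m' := (m + _)%MM.
case/(lead_exps_homog I_homog) => p [Ip pm /dhomogP hp].
(* By [wrevlex_last], each monomial of [p] has at least the [y]-exponent of the leading one, which
   is positive. *)
have [q qE] : exists q, p = q * 'X_ord_max.
  apply: mpolyX_dvd => m1 m1p; rewrite lep1mP.
  have [->|ne] := eqVneq m1 (m' + Uy)%MM.
    by rewrite mnmDE mnm1E eqxx addn1.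
  have := wrevlex_last _ (pm.2 _ m1p ne); rewrite hp // mnmDE mnm1E eqxx addn1.
  by move=> /(_ erefl); case: (m1 _).
exists q; last by apply: (@wlead_mulX_inv _ _ _ _ _ Uy); rewrite -qE.
apply/pi_eq0/last_nzd; rewrite mulr0 -pi_mul; apply/pi_eq0.
by rewrite mulrC -qE.
Qed.

Lemma B1E u : B1 w Iset u <->
  [/\ u (pen n) = 0%N, u ord_max = 0%N, ~ G u & exists k, G (u + Ux *+ k)%MM].
Proof.
split=> [[/B0E[ux uy nG] /= /(JE ux uy)[k [l]]]|[ux uy nG [k Gk]]].
  by rewrite lead_exps_last => Gk; split=> //; exists k.
split; first exact/B0E.
by apply/(JE ux uy); exists k, 0%N; rewrite lead_exps_last.
Qed.

(** The exponents [e] that bring [u] into in(I) are closed upwards. They exist for [u] in B1, so the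
    default value in [delta] is never reached. *)
Lemma deltaP u e : B1 w Iset u -> G (u + Ux *+ e)%MM <-> (delta w Iset u <= e)%N.
Proof.
case/B1E => _ _ _ Gex.
have GE d : initial_ideal w Iset ('X_[u] * 'X_(pen n) ^+ d) <-> G (u + Ux *+ d)%MM.
  by rewrite mpolyXn -mpolyXD; exact: (initial_idealX w (@idealMX _ _ I)).
have [d [Gd dmin]] : exists d, G (u + Ux *+ d)%MM /\
    forall e, G (u + Ux *+ e)%MM -> (d <= e)%N.
  have exP : exists d, `[< G (u + Ux *+ d)%MM >].
    by case: Gex => d Gd; exists d; apply/asboolP.
  have [d /asboolP Gd dmin] := ex_minnP exP.
  by exists d; split=> // e' Ge'; apply: dmin; apply/asboolP.
rewrite /delta; case: xgetP => [d' _ [/GE Gd' d'min]|/(_ d)[]]; last first.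
  by split=> [|e' /GE /dmin//]; apply/GE.
split=> [/GE /d'min//|/subnKC <-].
have -> : (Ux *+ (d' + (e - d')) = Ux *+ d' + Ux *+ (e - d'))%MM.
  by apply/mnmP => i; rewrite mnmDE !mulmnE mulnDr.
by rewrite addmA; apply: (lead_expsD (@idealMX _ _ I)).
Qed.

End NonZeroDivisor.

(** Only the constant term of [c] contributes a monomial free of [x] and [y]. *)
Lemma comp_last2_mulX c (i : 'I_n.+2) j m : (i < n)%N ->
  m (pen n) = 0%N -> m ord_max = 0%N ->
  ((c \mPo [tuple ('X_(pen n) : R); 'X_ord_max]) * 'X_i ^+ j)@_m =
  c@_0%MM * (m == (U_(i) *+ j)%MM)%:R.
Proof.
move=> ilt mx my.
have ix : (i == pen n) = false by apply/eqP => e; rewrite e val_pen ltnn in ilt.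
have iy : (i == ord_max) = false by apply/eqP => e; rewrite e /= ltnNge leqnSn in ilt.
have E (a : 'X_{1..2}) : (('X_[a] \mPo [tuple ('X_(pen n) : R); 'X_ord_max]) * 'X_i ^+ j)@_m =
    ((a == 0%MM) && (m == (U_(i) *+ j)%MM))%:R.
  rewrite comp_mpolyX big_ord_recl big_ord1 !(tnth_nth 0) /= !mpolyXn -!mpolyXD mcoeffX.
  congr ((_ : bool)%:R); apply/eqP/andP => [e|[/eqP -> /eqP ->]]; last first.
    by rewrite !mnm0E !mulm0n !add0m.
  have a0 : a = 0%MM.
    have ex := congr1 (fun m : M => m (pen n)) e.
    have ey := congr1 (fun m : M => m ord_max) e.
    rewrite mx !mnmDE !mulmnE !mnm1E ix eqxx mul1n mul0n addn0 in ex.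
    rewrite my !mnmDE !mulmnE !mnm1E iy eqxx mul1n mul0n addn0 in ey.
    move/eqP: ex; move/eqP: ey; rewrite !addn_eq0 => /andP[_ /eqP a1] /andP[/eqP a0 _].
    apply/mnmP => l; rewrite mnm0E.
    by case: (unliftP ord0 l) => [l'|] ->; rewrite ?(ord1 l').
  by rewrite a0 eqxx -e a0 !mnm0E !mulm0n !add0m.
rewrite (mpolyE c) !raddf_sum mulr_suml raddf_sum /= mulr_suml.
apply: eq_bigr => a _; rewrite comp_mpolyZ -scalerAl !mcoeffZ E mcoeffX -mulrA -natrM.
by rewrite mulnb.
Qed.

Lemma lead_exps_power (i : 'I_n.+2) : integralRange (last2_embed I) ->
  (i < n)%N -> exists k, G (U_(i) *+ k)%MM.
Proof.
move=> intI ilt; have [p /monicP p_monic] := intI (\pi_{ideal_quot I} 'X_i).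
rewrite rootE /map_poly horner_poly => /eqP p_root.
pose t := [tuple ('X_(pen n) : R); 'X_ord_max].
(* The integral equation of the class of ['X_i], lifted to [R]. *)
pose q := \sum_(j < size p) (p`_j \mPo t) * 'X_i ^+ j.
have Iq : q \in I.
  apply/pi_eq0; rewrite pi_sum -[RHS]p_root; apply: eq_bigr => j _.
  rewrite pi_mul; congr (_ * _).
  exact: (rmorphXn (\pi_{ideal_quot I} : {rmorphism _ -> _})).
have qE m : m (pen n) = 0%N -> m ord_max = 0%N ->
    q@_m = \sum_(j < size p) (p`_j)@_0%MM * (m == (U_(i) *+ j)%MM)%:R.
  by move=> mx my; rewrite raddf_sum; apply: eq_bigr => j _; exact: comp_last2_mulX.
have Uinj : injective (fun j => U_(i) *+ j)%MM.
  by move=> j k /mnmP/(_ i); rewrite !mulmnE !mnm1E eqxx !mul1n.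
have size_p : (0 < size p)%N.
  by rewrite lt0n size_poly_eq0 -lead_coef_eq0 p_monic oner_eq0.
(* [k] is the degree of the monic equation, so ['X_i ^+ k] has coefficient 1 in [q]. *)
pose k := (size p).-1; have ksize : (k < size p)%N by rewrite prednK.
have Ux0 j : (U_(i) *+ j)%MM (pen n) = 0%N.
  rewrite mulmnE mnm1E; case: eqP => // e.
  by rewrite e val_pen ltnn in ilt.
have Uy0 j : (U_(i) *+ j)%MM ord_max = 0%N.
  rewrite mulmnE mnm1E; case: eqP => // e.
  by rewrite e /= ltnNge leqnSn in ilt.
exists k, (pihomog (wdeg w) (wdeg w (U_(i) *+ k)%MM) q); first exact: I_homog.
split=> [|m].
  rewrite mem_msupp_pihomog eqxx mcoeff_msupp qE // (bigD1 (Ordinal ksize)) //=.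
  rewrite eqxx mulr1 -/(lead_coef p) p_monic mcoeff1 eqxx big1 ?addr0 ?oner_eq0 //.
  move=> j /eqP jk; case: eqP => [/Uinj e|]; last by rewrite mulr0.
  by case: jk; apply: val_inj.
rewrite mem_msupp_pihomog => /andP[/eqP md mq] ne.
have [|] := boolP ((m (pen n) != 0%N) || (m ord_max != 0%N)).
  by apply: wrevlex_last2.
(* A monomial of [q] free of [x] and [y] is a power of ['X_i]. As [w i] is positive, only the
   exponent [k] gives the right degree. *)
rewrite negb_or !negbK => /andP[/eqP mx /eqP my]; move: mq.
rewrite mcoeff_msupp qE // big1 ?eqxx // => j _.
case: eqP => [e|]; last by rewrite mulr0.
move: md ne; rewrite e !wdegMn wdeg1 => /eqP; rewrite eqn_pmul2l //.
by move=> /eqP ->; rewrite eqxx.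
Qed.

Lemma finite_B0 : integralRange (last2_embed I) -> finite_set (B0 w Iset).
Proof.
move=> intI.
(* The bound [i < n] is put under the existential so that one function [k] is chosen on all indices;
   these values bound the exponents of a standard monomial. *)
have Gex (i : 'I_n.+2) : exists k, (i < n)%N -> G (U_(i) *+ k)%MM.
  have [ilt|] := boolP (i < n)%N; last by exists 0%N.
  by have [k Gk] := lead_exps_power intI ilt; exists k.
have [k Gk] := boolp.choice Gex.
apply: sub_finite_set (@finite_mdeg_lt n.+2 (\sum_i k i).+1)%N => v /B0E[vx vy nG] /=.
rewrite ltnS mdegE; apply: leq_sum => i _.
case: (index_cases i) => [ilt|->|->]; rewrite ?vx ?vy //.
apply: contrapT => /negP; rewrite -ltnNge => kv; apply: nG.
rewrite -(@submK _ (U_(i) *+ k i)%MM v) 1?addmC.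
  exact: (lead_expsD (@idealMX _ _ I)) (Gk i ilt).
apply/mnm_lepP => j; rewrite mulmnE mnm1E.
by case: eqP => [<-|//]; rewrite mul1n ltnW.
Qed.

End Ideal.
End LastTwo.

(** * Counting finite sets of monomials *)

Section Counting.
Variable T : choiceType.

(** The cardinality is taken in [int] so that counts can be subtracted. *)
Definition count_set (A : set T) : int := \sum_(m \in A) (1 : int).

Lemma count_setID (B A : set T) : finite_set A ->
  count_set A = count_set (A `&` B) + count_set (A `&` ~` B).
Proof. exact: fsbigID. Qed.

Lemma count_set0 : count_set set0 = 0.
Proof. exact: fsbig_set0. Qed.

Lemma coef_fsumXn (A : set T) (e : T -> nat) k : finite_set A ->
  (\sum_(v \in A) ('X^(e v) : {poly int}))`_k = count_set (A `&` [set v | e v = k]).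
Proof.
move=> finA; rewrite /count_set fsbig_mkcondr !fsbig_finite // coef_sum.
apply: eq_bigr => v _; rewrite coefXn eq_sym.
have -> : (v \in [set v | e v = k]) = (e v == k) by apply/idP/eqP; rewrite inE.
by case: eqP.
Qed.

End Counting.

Lemma count_image (T U : choiceType) (h : T -> U) (P : set T) (Q : set U) :
  set_inj P h -> h @` P = Q -> count_set Q = count_set P.
Proof. by move=> h_inj <-; rewrite /count_set fsbig_image. Qed.

(** * Recurrences for the numbers of standard monomials *)

Section Hilbert.
Variables (K : fieldType) (n : nat) (w : 'I_n.+2 -> nat).
Hypothesis w_gt0 : forall i, (0 < w i)%N.
Variable I : idealr {mpoly K[n.+2]}.
Hypothesis I_homog : whomogeneous w I.
Hypothesis last_nzd : GRing.lreg (\pi_{ideal_quot I} 'X_ord_max).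
Local Notation Iset := [set p | p \in I].
Local Notation G := (lead_exps w Iset).
Local Notation M := 'X_{1..n.+2}.
Local Notation Ux := (U_(pen n))%MM.
Local Notation Uy := (U_(ord_max : 'I_n.+2))%MM.
Local Notation GD := (lead_expsD (@idealMX _ _ I)).

Let S d := [set m : M | ~ G m /\ wdeg w m = d].
Let T d := S d `&` [set m : M | m ord_max = 0%N].
(** [N d] collects the terms subtracted in degree [d] in the numerator. *)
Let N d := [set u | B1 w Iset u /\ (wdeg w u + delta w Iset u * w (pen n))%N = d].

Let finite_S d : finite_set (S d).
Proof. by apply: sub_finite_set (finite_wdeg w_gt0 d) => m []. Qed.

Let finite_T d : finite_set (T d).
Proof. exact: finite_setIl. Qed.

(** Multiplication by [y] is a bijection from the standard monomials of degree [d - w ord_max] onto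
    those of degree [d] divisible by [y]. *)
Lemma count_S d : count_set (S d) =
  count_set (T d) + (if (d < w ord_max)%N then 0 else count_set (S (d - w ord_max))).
Proof.
rewrite (count_setID [set m : M | m ord_max = 0%N]) //; congr (_ + _).
case: ltnP => dy.
  rewrite -(count_set0 M); congr count_set; apply/seteqP; split=> // m [[_ md] /= /eqP my].
  move: dy; rewrite -md -(@submK _ Uy m) ?lep1mP // wdegD wdeg1.
  by rewrite ltnNge leq_addl.
apply: (@count_image _ _ (fun m => m + Uy)%MM) => [m m' _ _|]; first exact: addIm.
apply/seteqP; split=> [_ [m [nG md] <-]|m [[nG md] /= /eqP my]].
  split; last by rewrite /= mnmDE mnm1E eqxx addn1.
  split; last by rewrite wdegD wdeg1 md subnK.
  by rewrite -[Uy]mulm1n (lead_exps_last I_homog last_nzd).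
have mE : (m - Uy + Uy)%MM = m by rewrite submK // lep1mP.
exists (m - Uy)%MM => //; split; last by rewrite -md -[in RHS]mE wdegD wdeg1 addnK.
by move=> /(GD Uy); rewrite mE.
Qed.

Lemma count_T d : count_set (T d) =
  count_set (B0 w Iset `&` [set v : M | wdeg w v = d]) +
  count_set (T d `&` [set m : M | m (pen n) <> 0%N]).
Proof.
rewrite (count_setID [set m : M | m (pen n) = 0%N]) //; congr (count_set _ + _).
apply/seteqP; split=> [m [[[nG md] my] mx]|m [/B0E[//|mx my nG] md]] //.
by split=> //; apply/B0E.
Qed.

(** Multiplication by [x] sends the monomials of [T (d - w (pen n))] that stay standard onto those
    of [T d] divisible by [x]. Each remaining one is the last standard multiple of some [u] in B1 by
    a power of [x]. *)
Lemma count_T_pen d : (w (pen n) <= d)%N ->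
  count_set (T (d - w (pen n))) =
  count_set (T d `&` [set m : M | m (pen n) <> 0%N]) + count_set (N d).
Proof.
move=> dx; rewrite (count_setID [set m : M | ~ G (m + Ux)%MM]) //; congr (_ + _).
  apply/esym/(@count_image _ _ (fun m => m + Ux)%MM) => [m m' _ _|]; first exact: addIm.
  apply/seteqP; split=> [_ [m [[[_ md] my] nG] <-]|m [[[nG md] my] /= /eqP mx]].
    split; last by rewrite /= mnmDE mnm1E eqxx addn1.
    split; first by split=> //; rewrite wdegD wdeg1 md subnK.
    by rewrite /= mnmDE mnm1E pen_neq_last my.
  have mE : (m - Ux + Ux)%MM = m by rewrite submK // lep1mP.
  exists (m - Ux)%MM => //; split; last by rewrite /= mE.
  split; last by rewrite /= mnmBE my.
  split; last by rewrite -md -[in RHS]mE wdegD wdeg1 addnK.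
  by move=> /(GD Ux); rewrite mE.
have dP := deltaP I_homog last_nzd.
have delta_gt0 u : B1 w Iset u -> (0 < delta w Iset u)%N.
  move=> u1; rewrite ltnNge; apply/negP => /(dP _ _ u1).
  by case/(B1E I_homog last_nzd): u1 => _ _ nG _; rewrite mulm0n addm0.
(* ['X_[u]] times the last power of [x] that keeps it standard. The predecessor is genuine because
   [delta] is positive on B1. *)
pose h u := (u + Ux *+ (delta w Iset u).-1)%MM.
apply: (@count_image _ _ h) => [u u'|].
  move=> /set_mem[/(B1E I_homog last_nzd)[ux _ _ _] _].
  move=> /set_mem[/(B1E I_homog last_nzd)[ux' _ _ _] _] /mnmP e.
  apply/mnmP => i; have := e i; rewrite /h !mnmDE !mulmnE !mnm1E.
  by case: eqP => [<-|_]; rewrite ?ux ?ux' // !mul0n !addn0.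
apply/seteqP; split=> [_ [u [u1 ud] <-]|m [[[nG md] /= my] /contrapT Gm]].
  have u0 := delta_gt0 u u1.
  have [ux uy _ _] := (B1E I_homog last_nzd u).1 u1.
  split; last first.
    by apply; rewrite /h -addmA -mulmSr prednK //; apply/dP.
  split; last by rewrite /= /h mnmDE mulmnE mnm1E pen_neq_last uy.
  split; first by rewrite /h => /(dP _ _ u1); rewrite leqNgt prednK // leqnn.
  by rewrite -ud wdegD wdegMn wdeg1 -[in RHS](prednK u0) mulSn addnCA addKn mulnC.
(* The preimage of [m] under [h] is [m] stripped of its power of [x]. As [m] is standard and
   [m + Ux] is not, [delta] of it is one more than the [x]-exponent of [m]. *)
pose u := (m - Ux *+ m (pen n))%MM.
have mE : (u + Ux *+ m (pen n))%MM = m.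
  rewrite /u submK //; apply/mnm_lepP => i; rewrite mulmnE mnm1E.
  by case: eqP => [<-|//]; rewrite mul1n.
have u1 : B1 w Iset u.
  apply/(B1E I_homog last_nzd); split.
  - by rewrite mnmBE mulmnE mnm1E eqxx mul1n subnn.
  - by rewrite mnmBE my.
  - by move=> /(GD (Ux *+ m (pen n))%MM); rewrite mE.
  by exists (m (pen n)).+1; rewrite mulmSr addmA mE.
have du : delta w Iset u = (m (pen n)).+1.
  apply/eqP; rewrite eqn_leq; apply/andP; split.
    by apply/dP => //; rewrite mulmSr addmA mE.
  by rewrite ltnNge; apply/negP => /(dP _ _ u1); rewrite mE.
exists u; last by rewrite /h du.
split=> //; rewrite du mulSn addnCA.
by have := md; rewrite -{1}mE wdegD wdegMn wdeg1 mulnC => ->; rewrite subnKC.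
Qed.

(** The numerator is 1 - t^(w (pen n)) times the generating series of [T]: the terms of [count_T]
    and [count_T_pen] counting multiples of [x] cancel. *)
Lemma hilbert_coef d : finite_set (B0 w Iset) ->
  (\sum_(v \in B0 w Iset) ('X^(wdeg w v) : {poly int})
   - \sum_(u \in B1 w Iset)
       ('X^(wdeg w u + delta w Iset u * w (pen n)) : {poly int}))`_d =
  count_set (T d) -
    (if (d < w (pen n))%N then 0 else count_set (T (d - w (pen n)))).
Proof.
move=> finB0; have finB1 : finite_set (B1 w Iset) by exact: finite_setIl.
rewrite coefB !coef_fsumXn // count_T; set N' := count_set (B1 _ _ `&` _).
have -> : N' = count_set (N d) by congr count_set; apply/seteqP; split.
case: ltnP => dx; last first.
  by rewrite count_T_pen // opprD addrA addrK.
(* Below degree [w (pen n)] nothing is subtracted, since [delta] is at least 1 on B1. *)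
have -> : N d = set0.
  apply/seteqP; split=> // u [u1 ud]; move: dx; rewrite -ud.
  rewrite ltnNge (leq_trans _ (leq_addl _ _)) // leq_pmull // ltnNge.
  apply/negP => /(deltaP I_homog last_nzd _ u1).
  by case/(B1E I_homog last_nzd): u1 => _ _ nG _; rewrite mulm0n addm0.
have -> : T d `&` [set m : M | m (pen n) <> 0%N] = set0.
  apply/seteqP; split=> // m [[[_ md] _] /= /eqP mx].
  move: dx; rewrite -md -(@submK _ Ux m) ?lep1mP // wdegD wdeg1.
  by rewrite ltnNge leq_addl.
by rewrite !count_set0 !(addr0, subr0).
Qed.

End Hilbert.

(** * From counts to the rational form of the series *)

Lemma sum_mul_coef_poly (f : nat -> int) (D : {poly int}) k :
  \sum_(i < k.+1) f i * D`_(k - i) = (\poly_(i < k.+1) f i * D)`_k.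
Proof. by rewrite coefM; apply: eq_bigr => i _; rewrite coef_poly ltn_ord. Qed.

Lemma coef_mul1BXn (p : {poly int}) e k :
  (p * (1 - 'X^e))`_k = p`_k - (if (k < e)%N then 0 else p`_(k - e)).
Proof. by rewrite mulrBr mulr1 coefB coefMXn. Qed.

Theorem corollary1 (K : fieldType) (K_infinite : infinite_set [set: K])
    (n : nat) (w : 'I_n.+2 -> nat) (w_gt0 : forall i, (0 < w i)%N)
    (I : idealr {mpoly K[n.+2]}) (I_homog : whomogeneous w I)
    (I_dim : has_krull_dim {ideal_quot I} 2)
    (I_noether : noether_normalization (last2_embed I))
    (x_last_nzd : GRing.lreg (\pi_{ideal_quot I} 'X_ord_max)) :
  let Iset : set {mpoly K[n.+2]} := [set p | p \in I] in
  series_eq_frac (hilbert_series I w)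
    (\sum_(v \in B0 w Iset) ('X^(wdeg w v) : {poly int})
     - \sum_(u \in B1 w Iset)
         ('X^(wdeg w u + delta w Iset u * w (pen n)) : {poly int}))
    ((1 - 'X^(w (pen n))) * (1 - 'X^(w ord_max))).
Proof.
move=> Iset; split=> [|k].
  (* Positive weights make the constant coefficient of the denominator equal to 1. *)
  rewrite coef0M !coefB !coef1 !coefXn /= ![0%N == _]eq_sym.
  by rewrite !gtn_eqF // !subr0 mulr1 unitr1.
have finB0 := finite_B0 w_gt0 I_homog (proj2 I_noether).
rewrite sum_mul_coef_poly hilbert_coef // mulrCA mulrC coef_mul1BXn.
set F := \poly_(i < k.+1) _.
(* The factor 1 - t^(w ord_max) turns the Hilbert series into the series of monomials free of [y];
   this holds up to degree [k], where [F] is truncated. The other factor then yields the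
   numerator. *)
have FE j : (j <= k)%N -> (F * (1 - 'X^(w ord_max)))`_j =
    count_set ([set m | ~ lead_exps w Iset m /\ wdeg w m = j] `&` [set m | m ord_max = 0%N]).
  move=> jk; rewrite coef_mul1BXn !coef_poly !ltnS jk (leq_trans (leq_subr _ _) jk).
  rewrite !hilbert_seriesE // -!/(count_set _).
  by rewrite (count_S w_gt0 I_homog x_last_nzd j) addrK.
by rewrite FE // FE ?leq_subr.
Qed.
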